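(* Let $n$ be a positive integer and $d$ a divisor of $n$. Then $KD(d)$ embeds as a Kac subalgebra into $KD(n)$ via the morphism $\varphi_k$ defined by $\varphi_k(\alpha)=a^k$ and $\varphi_k(\beta)=b$, where $k=\frac nd$, and $\alpha$ and $\beta$ denote the generators of $KD(d)$ (the rotation and the reflection of $D_{2d}$) and $a,b$ those of $KD(n)$. Furthermore, all the coideal subalgebras of $KD(n)$ containing $H=\langle a^n,b\rangle$ are obtained this way.
   Context: A finite-dimensional Kac algebra is a finite-dimensional $C^*$-algebra $K$ with a Hopf algebra structure $(\Delta,\varepsilon,S)$ for which $\Delta$ is a $*$-homomorphism. A coideal subalgebra of $K$ is a unital $*$-subalgebra $I$ with $\Delta(I)\subset K\otimes I$; it is a Kac subalgebra if it is stable under $\Delta$ and $S$. $KD(n)$ ($n\ge1$): let $D_{2n}=\langle a,b\mid a^{2n}=b^2=1,\ ba=a^{-1}b\rangle$ (order $4n$), with canonical basis $\lambda(g)$ of $\mathbb{C}[D_{2n}]$ (group elements are identified with their images), and $\Delta_s(\lambda(g))=\lambda(g)\otimes\lambda(g)$. Put $h_1=1,h_2=a^n,h_3=b,h_4=ba^n$, $\nu=-1+2\mathrm{i}$, and $\Omega=\sum_{i,j}c_{i,j}\lambda(h_i)\otimes\lambda(h_j)$ with $$(c_{i,j})=\frac18\begin{pmatrix}5&1&1&1\\1&1&\bar\nu&\nu\\1&\nu&1&\bar\nu\\1&\bar\nu&\nu&1\end{pmatrix}.$$ $\Omega$ is unitary. $KD(n)$ is the $*$-algebra $\mathbb{C}[D_{2n}]$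 with its usual counit and antipode and the coproduct $\Delta(x)=\Omega\Delta_s(x)\Omega^*$. *)

(* Defs.v *)
From HB Require Import structures.
From mathcomp Require Import all_boot all_order all_fingroup all_algebra.
From mathcomp Require Import all_solvable all_field.
From mathcomp Require Import complex reals.

Set Implicit Arguments.
Unset Strict Implicit.
Unset Printing Implicit Defensive.

Import GroupScope GRing.Theory Num.Theory.
Local Open Scope ring_scope.

(* For n > 0 this is the dihedral group D_{2n} of order 4n; the pair (i, s)   *)
(* encodes a^i b^s, with a = drot n and b = drefl n. Only n > 0 is meaningful:  *)
(* 'Z_(2 * 0) is Z/2.                                                         *)
Definition dih (n : nat) : Type := ('Z_(2 * n) * bool)%type.

HB.instance Definition _ n := Finite.copy (dih n) ('Z_(2 * n) * bool)%type.

Section DihedralGroup.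
Variable n : nat.

Definition dih_one : dih n := (0, false).
Definition dih_inv (x : dih n) : dih n := (if x.2 then x.1 else - x.1, x.2).
Definition dih_mul (x y : dih n) : dih n :=
  (x.1 + (if x.2 then - y.1 else y.1), x.2 (+) y.2).

Fact dih_mulA : associative dih_mul.
Proof.
by case=> [i []] [j []] [k []]; rewrite /dih_mul /= ?opprD ?opprK ?addrA.
Qed.

Fact dih_mul1 : left_id dih_one dih_mul.
Proof. by case=> [i s]; rewrite /dih_mul /= add0r. Qed.

Fact dih_mulV : left_inverse dih_one dih_inv dih_mul.
Proof. by case=> [i []]; rewrite /dih_mul /= ?subrr ?addNr. Qed.

HB.instance Definition _ :=
  Finite_isGroup.Build (dih n) dih_mulA dih_mul1 dih_mulV.

Definition drot : dih n := (1, false).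
Definition drefl : dih n := (0, true).

End DihedralGroup.

Arguments drot : clear implicits.
Arguments drefl : clear implicits.

Lemma drotX n k : (drot n ^+ k)%g = (k%:R, false).
Proof.
elim: k => [|k IHk] //; rewrite expgS IHk.
by congr pair; rewrite /= -natr1 addrC.
Qed.

Lemma drotXrefl n (i : 'Z_(2 * n)) (s : bool) : (drot n ^+ i * drefl n ^+ s)%g = (i, s).
Proof.
by rewrite drotX natr_Zp; case: s; congr pair; rewrite /= addr0.
Qed.

Lemma dih_relations n : (0 < n)%N ->
  [/\ (drot n ^+ (2 * n))%g = 1%g, (drefl n ^+ 2)%g = 1%g,
      (drefl n * drot n)%g = ((drot n)^-1 * drefl n)%g,
      <<[set drot n; drefl n]>>%g = [set: dih n] & #|[set: dih n]| = (4 * n)%N].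
Proof.
move=> n_gt0; have gt1: (1 < 2 * n)%N by rewrite mul2n -addnn (leq_add n_gt0).
split=> //.
- by rewrite drotX; congr pair; rewrite pchar_Zp.
- by congr pair; rewrite /= oppr0 addr0.
- by congr pair; rewrite /= add0r addr0.
- apply/eqP; rewrite eqEsubset subsetT; apply/subsetP=> [[i s]] _.
  by rewrite -drotXrefl groupM ?groupX // mem_gen // !inE eqxx ?orbT.
by rewrite cardsT card_prod card_bool card_ord Zp_cast // mulnAC.
Qed.

Lemma dih_isog n : (0 < n)%N -> [set: dih n] \isog [set: 'D_(4 * n)].
Proof.
move=> n_gt0; have [a2n b2 ba gen card] := dih_relations n_gt0.
have q_gt1: (1 < 2 * n)%N by rewrite mul2n -addnn (leq_add n_gt0).
have def4n : (4 * n)%N = (2 * n).*2 by rewrite -mul2n mulnA.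
rewrite isogEcard card def4n card_dihedral // leqnn andbT.
rewrite (Grp_dihedral q_gt1); apply/existsP; exists (drot n, drefl n) => /=.
rewrite joing_idl joing_idr -gen a2n b2 !xpair_eqE !eqxx /= !sub0r addr0.
by rewrite eqxx.
Qed.

(* The group algebra C[G], with lam the canonical basis: functions on G under *)
(* convolution. The alias hides the pointwise product of {ffun G -> C}.       *)
Definition galg (C : fieldType) (G : finGroupType) : Type := {ffun G -> C^o}.

Section GroupAlgebra.
Variables (C : fieldType) (G : finGroupType).
Local Notation A := (galg C G).
Implicit Types x y z : A.

HB.instance Definition _ := Vector.copy A {ffun G -> C^o}.

Definition lam (g : G) : A := [ffun h => (h == g)%:R].
Definition galg_mul x y : A := [ffun g => \sum_h x h * y (h^-1 * g)%g].

Fact galg_mulA : associative galg_mul.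
Proof.
move=> x y z; apply/ffunP=> g; rewrite !ffunE.
under eq_bigr => h _ do rewrite ffunE mulr_sumr.
under [RHS]eq_bigr => h _ do rewrite ffunE mulr_suml.
rewrite [RHS]exchange_big; apply: eq_bigr => h _ /=.
rewrite (reindex_inj (mulgI h^-1%g)) /=; apply: eq_bigr => k _.
by rewrite mulrA invMg invgK -mulgA mulKVg.
Qed.

Fact galg_mul1l : left_id (lam 1) galg_mul.
Proof.
move=> x; apply/ffunP=> g; rewrite ffunE (bigD1 1%g) //= ffunE eqxx mul1r.
rewrite invg1 mul1g big1 ?addr0 // => h /negPf h1.
by rewrite ffunE h1 mul0r.
Qed.

Fact galg_mul1r : right_id (lam 1) galg_mul.
Proof.
move=> x; apply/ffunP=> g; rewrite ffunE (bigD1 g) //= ffunE mulVg eqxx mulr1.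
rewrite big1 ?addr0 // => h /negPf hg.
by rewrite ffunE -eq_invg_mul invgK hg mulr0.
Qed.

Fact galg_mulDl : left_distributive galg_mul +%R.
Proof.
move=> x y z; apply/ffunP=> g; rewrite !ffunE -big_split.
by apply: eq_bigr => h _; rewrite ffunE mulrDl.
Qed.

Fact galg_mulDr : right_distributive galg_mul +%R.
Proof.
move=> x y z; apply/ffunP=> g; rewrite !ffunE -big_split.
by apply: eq_bigr => h _; rewrite ffunE mulrDr.
Qed.

Fact galg_1neq0 : lam 1 != 0.
Proof. by apply/eqP=> /ffunP/(_ 1%g)/eqP; rewrite !ffunE eqxx oner_eq0. Qed.

HB.instance Definition _ := GRing.Zmodule_isNzRing.Build A
  galg_mulA galg_mul1l galg_mul1r galg_mulDl galg_mulDr galg_1neq0.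

Fact galg_scaleAl (c : C) x y : c *: (x * y) = (c *: x) * y.
Proof.
apply/ffunP=> g; rewrite !ffunE scaler_sumr; apply: eq_bigr => h _.
by rewrite ffunE /= scalerAl.
Qed.

HB.instance Definition _ := GRing.Lmodule_isLalgebra.Build C A galg_scaleAl.

Fact galg_scaleAr (c : C) x y : c *: (x * y) = x * (c *: y).
Proof.
apply/ffunP=> g; rewrite !ffunE scaler_sumr; apply: eq_bigr => h _.
by rewrite ffunE /= scalerAr.
Qed.

HB.instance Definition _ := GRing.Lalgebra_isAlgebra.Build C A galg_scaleAr.
HB.instance Definition _ := Algebra_isFalgebra.Build C A.

Lemma lamM g h : lam (g * h)%g = lam g * lam h.
Proof.
apply/ffunP=> k; rewrite !ffunE (bigD1 g) //= !ffunE eqxx mul1r.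
rewrite big1 => [|l /negPf lg]; last by rewrite ffunE lg mul0r.
by rewrite addr0 (canF_eq (mulKVg g)).
Qed.

Lemma lam_sum x : x = \sum_g x g *: lam g.
Proof.
apply/ffunP=> h; rewrite sum_ffunE (bigD1 h) //= !ffunE eqxx.
rewrite big1 => [|g /negPf gh]; first by rewrite addr0 [RHS]mulr1.
by rewrite !ffunE eq_sym gh [LHS]mulr0.
Qed.

End GroupAlgebra.

Arguments lam C {G} g.

(* C[G] (x) C[H] is represented by C[G * H], with lam g (x) lam h given by    *)
(* lam (g, h). Here tens x y is x (x) y, tensv U V is the subspace U (x) V,   *)
(* and tensf f1 f2 is f1 (x) f2, for linear f1 and f2.                        *)
Section Tensor.
Variables (C : fieldType) (G H : finGroupType).

Definition tens (x : galg C G) (y : galg C H) : galg C (G * H)%type :=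
  [ffun p => x p.1 * y p.2].

Definition tensv (U : {vspace galg C G}) (V : {vspace galg C H}) :
    {vspace galg C (G * H)%type} :=
  <<[seq tens u v | u <- vbasis U, v <- vbasis V]>>%VS.

Lemma tens_lam g h : tens (lam C g) (lam C h) = lam C (g, h).
Proof.
by apply/ffunP=> -[g1 h1]; rewrite !ffunE xpair_eqE -natrM mulnb.
Qed.

Lemma tensDl x1 x2 y : tens (x1 + x2) y = tens x1 y + tens x2 y.
Proof. by apply/ffunP=> p; rewrite !ffunE mulrDl. Qed.

Lemma tensDr x y1 y2 : tens x (y1 + y2) = tens x y1 + tens x y2.
Proof. by apply/ffunP=> p; rewrite !ffunE mulrDr. Qed.

Lemma tensZl c x y : tens (c *: x) y = c *: tens x y.
Proof. by apply/ffunP=> p; rewrite !ffunE /= -scalerAl. Qed.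

Lemma tensZr c x y : tens x (c *: y) = c *: tens x y.
Proof. by apply/ffunP=> p; rewrite !ffunE /= -scalerAr. Qed.

Lemma memv_tens (U : {vspace galg C G}) (V : {vspace galg C H}) x y :
  x \in U -> y \in V -> tens x y \in tensv U V.
Proof.
have tens0l z : tens 0 z = 0 by rewrite -[0 in LHS](scale0r 0) tensZl scale0r.
have tens0r z : tens z 0 = 0 by rewrite -[0 in LHS](scale0r 0) tensZr scale0r.
move=> Ux Vy; rewrite (coord_vbasis Ux) (coord_vbasis Vy).
elim/big_ind: _ => [|x1 x2 Hx1 Hx2|i _]; first by rewrite tens0l mem0v.
  by rewrite tensDl memvD.
rewrite tensZl memvZ //.
elim/big_ind: _ => [|y1 y2 Hy1 Hy2|j _]; first by rewrite tens0r mem0v.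
  by rewrite tensDr memvD.
rewrite tensZr memvZ // memv_span //.
by apply: allpairs_f; apply: mem_nth; rewrite size_tuple.
Qed.

End Tensor.

Definition tensf (C : fieldType) (G1 H1 G2 H2 : finGroupType)
    (f1 : galg C G1 -> galg C G2) (f2 : galg C H1 -> galg C H2)
    (z : galg C (G1 * H1)%type) : galg C (G2 * H2)%type :=
  \sum_p z p *: tens (f1 (lam C p.1)) (f2 (lam C p.2)).

Lemma tensf_tens (C : fieldType) (G1 H1 G2 H2 : finGroupType)
    (f1 : {linear galg C G1 -> galg C G2})
    (f2 : {linear galg C H1 -> galg C H2}) x y :
  tensf f1 f2 (tens x y) = tens (f1 x) (f2 y).
Proof.
rewrite {2}(lam_sum x) {2}(lam_sum y) !linear_sum /=.
apply/ffunP=> p; rewrite !(sum_ffunE, ffunE) big_distrlr /=.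
rewrite pair_big; apply: eq_bigr => q _.
by rewrite !linearZ !ffunE /= /GRing.scale /= mulrACA.
Qed.

(* The Kac algebras considered all have the *-algebra structure, counit and   *)
(* antipode of some C[G]; only the coproduct varies.                          *)
Section KacStructure.
Variables (C : numClosedFieldType) (G : finGroupType).

Definition star (x : galg C G) : galg C G := [ffun g => (x g^-1%g)^*].
Definition counit (x : galg C G) : C := \sum_g x g.
Definition antipode (x : galg C G) : galg C G := [ffun g => x g^-1%g].
Definition coprod_s (x : galg C G) : galg C (G * G)%type :=
  \sum_g x g *: lam C (g, g).

Variable coprod : galg C G -> galg C (G * G)%type.
Implicit Type I : {vspace galg C G}.

Definition coideal_subalgebra I : Prop :=
  [/\ 1 \in I, {in I &, forall x y, x * y \in I},
      {in I, forall x, star x \in I}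
    & {in I, forall x, coprod x \in tensv fullv I}].

Definition kac_subalgebra I : Prop :=
  [/\ coideal_subalgebra I, {in I, forall x, coprod x \in tensv I I}
    & {in I, forall x, antipode x \in I}].

End KacStructure.

(* Injective morphism of Kac algebras; unital multiplicative linear maps are  *)
(* already bundled in 'AHom.                                                  *)
Definition kac_embedding (C : numClosedFieldType) (G H : finGroupType)
    (coprodG : galg C G -> galg C (G * G)%type)
    (coprodH : galg C H -> galg C (H * H)%type)
    (f : 'AHom(galg C G, galg C H)) : Prop :=
  [/\ injective f,
      forall x, f (star x) = star (f x),
      forall x, coprodH (f x) = tensf f f (coprodG x),
      forall x, counit (f x) = counit x
    & forall x, antipode (f x) = f (antipode x)].

Section KD.
Variables (C : numClosedFieldType) (n : nat).

Definition KD : falgType C := galg C (dih n).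
Definition KD2 : falgType C := galg C (dih n * dih n)%type.

Definition KD_a : KD := lam C (drot n).
Definition KD_b : KD := lam C (drefl n).

Definition KD_h : 4.-tuple (dih n) :=
  [tuple 1%g; (drot n ^+ n)%g; drefl n; (drefl n * drot n ^+ n)%g].

Definition KD_nu : C := -1 + 2 * 'i.

Definition KD_c : 'M[C]_4 :=
  let nu := KD_nu in
  8^-1 *: \matrix_(i, j) nth 0 (nth [::]
    [:: [:: 5; 1;    1;    1   ];
        [:: 1; 1;    nu^*; nu  ];
        [:: 1; nu;   1;    nu^*];
        [:: 1; nu^*; nu;   1   ]] i) j.

Definition KD_Omega : KD2 :=
  \sum_(i < 4) \sum_(j < 4)
    KD_c i j *: tens (lam C (tnth KD_h i)) (lam C (tnth KD_h j)).

Definition KD_coprod (x : KD) : KD2 :=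
  KD_Omega * coprod_s x * star KD_Omega.

End KD.

(* f is the algebra morphism phi_k, k = n / d, from KD(d) to KD(n).           *)
Definition is_phi (C : numClosedFieldType) (n d : nat)
    (f : 'AHom(KD C d, KD C n)) : Prop :=
  f (KD_a C d) = KD_a C n ^+ (n %/ d) /\ f (KD_b C d) = KD_b C n.

(* Main.v *)
From HB Require Import structures.
Require Import Defs.
From mathcomp Require Import all_boot all_order all_fingroup all_algebra.
From mathcomp Require Import all_solvable all_field.
From mathcomp Require Import complex reals.
From mathcomp Require Import ring.
Import GroupScope GRing.Theory Num.Theory.
Local Open Scope ring_scope.

(** Write k = n / d. The rule a^i b^s |-> a^(k i) b^s is an injective
    homomorphism from the dihedral group D_{2d} to D_{2n}: additivity of
    i |-> k i modulo 2n comes from 2n = k (2d). Its linear extension to the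
    group algebras, a pushforward of functions, is phi_k, and the images of the
    two generators leave no other choice. A pushforward along a group
    homomorphism is multiplicative and commutes with the star, the counit, the
    antipode and the group coproduct. It also maps the twist Omega of KD(d) to
    that of KD(n), because a^d goes to a^(k d) = a^n and b to b; so it commutes
    with the twisted coproducts too, and phi_k is an embedding of Kac algebras.
    The image of such an embedding is always a Kac subalgebra.

    Conversely, let I be a coideal subalgebra that contains C[H], where
    H = {1, a^n, b, b a^n}. Since Omega lies in C[H] (x) C[H] and is unitary,
    the group coproduct of x in I, which is Omega^* Delta(x) Omega, is still in
    K (x) I (coideal_lam). But that coproduct is the sum of the
    x_g lam(g) (x) lam(g), and reading off the coefficient of lam(g) in the
    first factor shows that lam(g) is in I whenever x_g <> 0. Hence I is spanned
    by the group elements that it contains. They form a subgroup S containing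
    a^n and b, and the least k > 0 with a^k in S divides n and generates the
    rotations of S, so I is the image of phi_k with d = n / k. *)

(** * Pushforward of group algebras *)

Definition pushforward {C : fieldType} {G H : finGroupType} (theta : G -> H)
  (x : galg C G) : galg C H := \sum_g x g *: lam C (theta g).

Lemma pushforward_is_linear (C : fieldType) (G H : finGroupType)
    (theta : G -> H) : linear (@pushforward C G H theta).
Proof.
move=> c x y; rewrite /pushforward scaler_sumr -big_split /=.
by apply: eq_bigr => g _; rewrite !ffunE scalerA -scalerDl.
Qed.

HB.instance Definition _ (C : fieldType) (G H : finGroupType) (theta : G -> H) :=
  GRing.isLinear.Build C (galg C G) (galg C H) *:%R (@pushforward C G H theta)
    (pushforward_is_linear C G H theta).

Lemma pushforward_lam (C : fieldType) (G H : finGroupType) (theta : G -> H) g :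
  pushforward theta (lam C g) = lam C (theta g).
Proof.
rewrite /pushforward (bigD1 g) //= ffunE eqxx scale1r big1 ?addr0 // => h.
by rewrite ffunE => /negPf->; rewrite scale0r.
Qed.

Lemma pushforwardE (C : fieldType) (G H : finGroupType) (theta : G -> H)
    (x : galg C G) h :
  pushforward theta x h = \sum_(g | theta g == h) x g.
Proof.
rewrite sum_ffunE [RHS]big_mkcond; apply: eq_bigr => g _.
rewrite !ffunE eq_sym /GRing.scale /=.
by case: eqP; rewrite ?mulr1 ?mulr0.
Qed.

Lemma linear_lam_ext {C : fieldType} {G : finGroupType} {V : lmodType C}
    (f1 f2 : {linear galg C G -> V}) :
  (forall g, f1 (lam C g) = f2 (lam C g)) -> f1 =1 f2.
Proof.
move=> f12 x; rewrite (lam_sum x) !linear_sum; apply: eq_bigr => g _.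
by rewrite !linearZ f12.
Qed.

Lemma pushforward_comp (C : fieldType) (G H K : finGroupType)
    (theta : H -> K) (eta : G -> H) (x : galg C G) :
  pushforward theta (pushforward eta x) = pushforward (theta \o eta) x.
Proof.
rewrite {2}/pushforward linear_sum; apply: eq_bigr => g _.
by rewrite linearZ /= pushforward_lam.
Qed.

Lemma eq_pushforward {C : fieldType} {G H : finGroupType}
    {theta eta : G -> H} (x : galg C G) :
  theta =1 eta -> pushforward theta x = pushforward eta x.
Proof. by move=> eq_te; apply: eq_bigr => g _; rewrite eq_te. Qed.

Lemma pushforward_inj {C : fieldType} {G H : finGroupType} {theta : G -> H} :
  injective theta -> injective (@pushforward C G H theta).
Proof.
move=> inj x y /ffunP exy; apply/ffunP=> g; have := exy (theta g).
rewrite !pushforwardE !(big_pred1 g) // => h; exact: inj_eq.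
Qed.

Lemma pushforward1 (C : fieldType) (G H : finGroupType) (theta : G -> H) :
  {morph theta : x y / (x * y)%g} -> pushforward theta 1 = 1 :> galg C H.
Proof.
move=> thetaM; rewrite pushforward_lam; congr lam.
by apply: (mulgI (theta 1%g)); rewrite -thetaM !mulg1.
Qed.

Lemma pushforwardM {C : fieldType} {G H : finGroupType} {theta : G -> H} :
  {morph theta : x y / (x * y)%g} ->
  {morph @pushforward C G H theta : x y / x * y}.
Proof.
move=> thetaM x y; rewrite (lam_sum x) mulr_suml !linear_sum mulr_suml.
apply: eq_bigr => g _; rewrite -scalerAl !linearZ /= -scalerAl; congr (_ *: _).
rewrite (lam_sum y) mulr_sumr !linear_sum mulr_sumr.
apply: eq_bigr => h _; rewrite -scalerAr !linearZ /= -scalerAr; congr (_ *: _).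
by rewrite -lamM !pushforward_lam thetaM lamM.
Qed.

Lemma morphg_inv {G H : finGroupType} {theta : G -> H} :
  {morph theta : x y / (x * y)%g} -> {morph theta : x / (x^-1)%g}.
Proof.
move=> thetaM x; apply: (mulgI (theta x)); rewrite -thetaM !mulgV.
by apply: (mulgI (theta 1%g)); rewrite -thetaM !mulg1.
Qed.

(** This turns statements about the antipode into instances of
    [pushforward_comp]. *)
Lemma antipodeE (C : numClosedFieldType) (G : finGroupType) (x : galg C G) :
  antipode x = pushforward invg x.
Proof.
apply/ffunP=> g; rewrite ffunE pushforwardE (big_pred1 g^-1%g) // => h.
by rewrite /= -eqg_invLR.
Qed.

Lemma antipode_pushforward {C : numClosedFieldType} {G H : finGroupType}
    {theta : G -> H} (x : galg C G) :
  {morph theta : x y / (x * y)%g} ->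
  antipode (pushforward theta x) = pushforward theta (antipode x).
Proof.
move=> thetaM; rewrite !antipodeE !pushforward_comp; apply: eq_pushforward => g.
by rewrite /= (morphg_inv thetaM).
Qed.

Lemma starE (C : numClosedFieldType) (G : finGroupType) (x : galg C G) :
  star x = \sum_g (x g)^* *: lam C g^-1%g.
Proof.
apply/ffunP=> g; rewrite ffunE sum_ffunE (bigD1 g^-1%g) //= !ffunE invgK eqxx.
rewrite [_ *: _]mulr1 big1 ?addr0 // => h /negPf ne_h.
by rewrite !ffunE -eqg_invLR eq_sym ne_h [LHS]mulr0.
Qed.

Lemma star_lam (C : numClosedFieldType) (G : finGroupType) (g : G) :
  star (lam C g) = lam C g^-1%g.
Proof.
apply/ffunP=> h; rewrite !ffunE rmorph_nat; congr (nat_of_bool _)%:R.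
by rewrite -eqg_invLR eq_sym.
Qed.

Lemma star_sum (C : numClosedFieldType) (G : finGroupType) (I : Type)
    (r : seq I) (F : I -> galg C G) :
  star (\sum_(i <- r) F i) = \sum_(i <- r) star (F i).
Proof.
apply/ffunP=> g; rewrite ffunE !sum_ffunE rmorph_sum.
by apply: eq_bigr => i _; rewrite ffunE.
Qed.

Lemma starZ (C : numClosedFieldType) (G : finGroupType) c (x : galg C G) :
  star (c *: x) = c^* *: star x.
Proof. by apply/ffunP=> g; rewrite !ffunE rmorphM. Qed.

Lemma star_pushforward {C : numClosedFieldType} {G H : finGroupType}
    {theta : G -> H} (x : galg C G) :
  {morph theta : x y / (x * y)%g} ->
  star (pushforward theta x) = pushforward theta (star x).
Proof.
move=> thetaM; rewrite star_sum starE linear_sum; apply: eq_bigr => g _.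
by rewrite starZ star_lam linearZ /= pushforward_lam (morphg_inv thetaM).
Qed.

Lemma counit_pushforward (C : numClosedFieldType) (G H : finGroupType)
    (theta : G -> H) (x : galg C G) :
  counit (pushforward theta x) = counit x.
Proof.
rewrite /counit [RHS](partition_big theta predT) //=.
by apply: eq_bigr => h _; rewrite pushforwardE.
Qed.

Definition prodmap {G H : finGroupType} (theta : G -> H) (p : G * G) : H * H :=
  (theta p.1, theta p.2).

Lemma prodmapM {G H : finGroupType} {theta : G -> H} :
  {morph theta : x y / (x * y)%g} -> {morph prodmap theta : x y / (x * y)%g}.
Proof. by move=> thetaM [x1 x2] [y1 y2]; rewrite /prodmap /= !thetaM. Qed.

(** Both sides are pushforwards along g |-> (theta g, theta g), since the group
    coproduct is itself the pushforward along the diagonal. *)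
Lemma coprod_s_pushforward (C : numClosedFieldType) (G H : finGroupType)
    (theta : G -> H) (x : galg C G) :
  coprod_s (pushforward theta x) = pushforward (prodmap theta) (coprod_s x).
Proof.
transitivity (pushforward (fun g => (g, g)) (pushforward theta x)); first by [].
by rewrite pushforward_comp -[coprod_s x]/(pushforward _ x) pushforward_comp.
Qed.

Lemma tensf_pushforward {C : numClosedFieldType} {G H : finGroupType}
    {theta : G -> H} (f : galg C G -> galg C H) (z : galg C (G * G)%type) :
  (forall g, f (lam C g) = lam C (theta g)) ->
  tensf f f z = pushforward (prodmap theta) z.
Proof. by move=> fE; apply: eq_bigr => p _; rewrite !fE tens_lam. Qed.

(** * The maps between dihedral groups *)

Definition dih_scale {n d : nat} (g : dih d) : dih n :=
  ((n %/ d * g.1)%N%:R, g.2).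

Lemma two_n_gt1 {n} : (0 < n)%N -> (1 < 2 * n)%N.
Proof. by case: n => // n _; rewrite mulnS. Qed.

(** The only subtle point is that multiplication by n %/ d is compatible with
    the reductions modulo 2d and 2n, because 2n = (n %/ d)(2d). *)
Lemma dih_scaleM {n d} : (0 < n)%N -> (d %| n)%N ->
  {morph @dih_scale n d : x y / (x * y)%g}.
Proof.
move=> n_gt0 d_n; have d_gt0 := dvdn_gt0 n_gt0 d_n.
have defn : (2 * n = n %/ d * (2 * d))%N by rewrite mulnCA divnK.
have scaleD (i j : 'Z_(2 * d)) : (n %/ d * (i + j)%R)%N%:R
   = (n %/ d * i)%N%:R + (n %/ d * j)%N%:R :> 'Z_(2 * n).
  have -> : (n %/ d * (i + j)%R = (n %/ d * (i + j)) %% (2 * n))%N.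
    rewrite defn -muln_modr; congr (_ * (_ %% _))%N.
    by apply: Zp_cast; rewrite two_n_gt1.
  by rewrite Zp_nat_mod ?two_n_gt1 // mulnDr natrD.
have scaleN (i : 'Z_(2 * d)) : (n %/ d * (- i)%R)%N%:R
   = - (n %/ d * i)%N%:R :> 'Z_(2 * n).
  by apply: (addrI (n %/ d * i)%N%:R); rewrite -scaleD !subrr muln0.
case=> [i []] [j s]; congr pair; last exact: scaleD.
exact: etrans (scaleD i (- j)) (congr1 _ (scaleN j)).
Qed.

Lemma dih_scaleX {n d} (x : dih d) m : (0 < n)%N -> (d %| n)%N ->
  dih_scale (x ^+ m)%g = (dih_scale x ^+ m)%g :> dih n.
Proof.
move=> n_gt0 d_n; elim: m => [|m IHm]; first by rewrite /dih_scale muln0.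
by rewrite !expgS dih_scaleM // IHm.
Qed.

Lemma dih_scale_inj {n d} : (0 < n)%N -> (d %| n)%N ->
  injective (@dih_scale n d).
Proof.
move=> n_gt0 d_n; have d_gt0 := dvdn_gt0 n_gt0 d_n.
have k_gt0 : (0 < n %/ d)%N by rewrite divn_gt0 // dvdn_leq.
have defn : (2 * n = n %/ d * (2 * d))%N by rewrite mulnCA divnK.
have lt2d (i : 'Z_(2 * d)) : (i < 2 * d)%N.
  by rewrite -[X in (_ < X)%N]Zp_cast ?two_n_gt1.
case=> [i s] [j t] [/(congr1 val) /=]; rewrite !val_Zp_nat ?two_n_gt1 //.
rewrite !modn_small ?defn ?ltn_pmul2l // => /eqP; rewrite eqn_pmul2l //.
by move=> /eqP/val_inj-> ->.
Qed.

Lemma dih_scale_rot n d : (0 < n)%N -> (d %| n)%N ->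
  dih_scale (drot d) = (drot n ^+ (n %/ d))%g.
Proof.
move=> n_gt0 d_n; rewrite drotX /dih_scale /=; congr (_%:R, _).
by rewrite modn_small ?muln1 // Zp_cast ?two_n_gt1 // (dvdn_gt0 n_gt0).
Qed.

Lemma dih_scale_refl n d : dih_scale (drefl d) = drefl n.
Proof. by rewrite /dih_scale muln0. Qed.

Lemma lamX {C : fieldType} {G : finGroupType} (g : G) m :
  lam C (g ^+ m)%g = lam C g ^+ m.
Proof. by elim: m => // m IHm; rewrite expgS exprS lamM IHm. Qed.

Lemma is_phi_lam {C : numClosedFieldType} {n d} {phi : 'AHom(KD C d, KD C n)} :
  (0 < n)%N -> (d %| n)%N -> is_phi phi ->
  forall g, phi (lam C g) = lam C (dih_scale g).
Proof.
move=> n_gt0 d_n [phi_a phi_b] [i s]; rewrite -drotXrefl.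
rewrite dih_scaleM // !dih_scaleX // dih_scale_rot // dih_scale_refl.
rewrite !lamM rmorphM /= !lamX !rmorphXn /= -[lam C (drot d)]/(KD_a C d).
by rewrite -[lam C (drefl d)]/(KD_b C d) phi_a phi_b.
Qed.

(** This gives at once the uniqueness of phi_k and all the properties of
    pushforwards along homomorphisms. *)
Lemma is_phiE {C : numClosedFieldType} {n d} {phi : 'AHom(KD C d, KD C n)} :
  (0 < n)%N -> (d %| n)%N -> is_phi phi ->
  forall x, phi x = pushforward dih_scale x.
Proof.
move=> n_gt0 d_n phiP; apply: linear_lam_ext => g.
by rewrite /= pushforward_lam is_phi_lam.
Qed.

Lemma is_phi_exists (C : numClosedFieldType) {n d} :
  (0 < n)%N -> (d %| n)%N -> exists phi : 'AHom(KD C d, KD C n), is_phi phi.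
Proof.
move=> n_gt0 d_n; have thetaM := dih_scaleM n_gt0 d_n.
pose f : 'Hom(KD C d, KD C n) := linfun (pushforward (@dih_scale n d)).
have fP : ahom_in {:KD C d} f.
  apply/ahomP_tmp; split=> [|x y]; rewrite !lfunE /=; first exact: pushforward1.
  exact: pushforwardM.
exists (AHom fP); split; rewrite lfunE /= pushforward_lam.
  by rewrite dih_scale_rot // lamX.
by rewrite dih_scale_refl.
Qed.

(** * The twist Omega *)

(** Bitwise exclusive or. The elements of the Klein four-group
    H = {1, a^n, b, b a^n} are numbered so that it is the group law of H. *)
Definition xor4 (i j : 'I_4) : 'I_4 :=
  inord (nth 0 (nth [::] [:: [:: 0; 1; 2; 3]; [:: 1; 0; 3; 2];
                             [:: 2; 3; 0; 1]; [:: 3; 2; 1; 0]] i) j)%N.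

(** Case analysis in terms of [inord], which reduces the identities on 'I_4
    below to computations with numerals through [inordK]. *)
Lemma I4_ind (P : 'I_4 -> Prop) :
  P (inord 0) -> P (inord 1) -> P (inord 2) -> P (inord 3) -> forall i, P i.
Proof.
move=> P0 P1 P2 P3 i; rewrite -(inord_val i).
by case: i => [[|[|[|[|]]]]].
Qed.

Lemma xor4K i : involutive (xor4^~ i).
Proof.
by move: i; apply: I4_ind; apply: I4_ind; apply: val_inj;
  rewrite /= /xor4 !inordK.
Qed.

Lemma rotX2n {n} : (0 < n)%N -> n%:R + n%:R = 0 :> 'Z_(2 * n).
Proof.
by move=> n_gt0; rewrite -natrD addnn -mul2n pchar_Zp ?two_n_gt1.
Qed.

Lemma KD_hM {n} : (0 < n)%N -> forall i j,
  (tnth (KD_h n) i * tnth (KD_h n) j)%g = tnth (KD_h n) (xor4 i j).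
Proof.
move=> n_gt0; have nn := rotX2n n_gt0.
have opp_n : - n%:R = n%:R :> 'Z_(2 * n) by apply/eqP; rewrite eq_sym -addr_eq0 nn.
by apply: I4_ind; apply: I4_ind; rewrite !(tnth_nth 1%g) /xor4 /= !inordK //=;
  rewrite ?drotX; congr pair; rewrite /= ?(add0r, addr0, oppr0, opp_n, nn).
Qed.

(** H has exponent 2, so the star of Omega only conjugates the coefficients. *)
Lemma KD_hV {n} : (0 < n)%N -> forall i,
  ((tnth (KD_h n) i)^-1)%g = tnth (KD_h n) i.
Proof.
move=> n_gt0 i; apply/eqP; rewrite eq_invg_mul KD_hM //; apply/eqP.
by move: i; apply: I4_ind; rewrite (tnth_nth 1%g) /xor4 /= !inordK.
Qed.

Lemma KD_OmegaE (C : numClosedFieldType) n :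
  KD_Omega C n = \sum_i \sum_j
    KD_c C i j *: lam C (tnth (KD_h n) i, tnth (KD_h n) j).
Proof.
by apply: eq_bigr => i _; apply: eq_bigr => j _; rewrite tens_lam.
Qed.

Lemma star_KD_OmegaE (C : numClosedFieldType) {n} : (0 < n)%N ->
  star (KD_Omega C n) = \sum_i \sum_j
    (KD_c C i j)^* *: lam C (tnth (KD_h n) i, tnth (KD_h n) j).
Proof.
move=> n_gt0; rewrite KD_OmegaE star_sum; apply: eq_bigr => i _.
rewrite star_sum; apply: eq_bigr => j _; rewrite starZ star_lam.
by congr (_ *: lam C (_, _)); apply: KD_hV.
Qed.

Lemma sum_I4 {V : nmodType} (F : 'I_4 -> V) :
  \sum_i F i = F (inord 0) + F (inord 1) + F (inord 2) + F (inord 3).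
Proof.
rewrite !big_ord_recl big_ord0 addr0 !addrA.
by do !congr (_ + _); congr F; apply: val_inj; rewrite /= inordK.
Qed.

(** The coefficients of the product of the star of Omega with Omega: products in
    C[H] (x) C[H] are convolutions for [xor4]. Each of the sixteen identities
    follows from nu + nu^* = -2 and nu nu^* = 5. *)
Lemma KD_c_unitary (C : numClosedFieldType) (p q : 'I_4) :
  \sum_k \sum_l (KD_c C (xor4 p k) (xor4 q l))^* * KD_c C k l
  = ((p == inord 0) && (q == inord 0))%:R.
Proof.
set nu := KD_nu C.
have nu_conj : nu^* = - 2 - nu.
  rewrite /nu /KD_nu rmorphD rmorphN rmorphM rmorph1 /= conjCi rmorph_nat.
  by ring.
(* This is nu * nu^* = 5 in terms of nu alone. *)
have nu_sqr : nu * nu = - 2 * nu - 5.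
  by rewrite /nu /KD_nu; have := sqrCi C; rewrite expr2 => ii; ring: ii.
have entry a b : (a < 4)%N -> (b < 4)%N -> KD_c C (inord a) (inord b) =
    8^-1 * nth 0 (nth [::] [:: [:: 5; 1; 1; 1]; [:: 1; 1; - 2 - nu; nu];
                       [:: 1; nu; 1; - 2 - nu]; [:: 1; - 2 - nu; nu; 1]] a) b.
  by move=> a4 b4; rewrite !mxE !inordK // -nu_conj.
have xorE a b : (a < 4)%N -> (b < 4)%N -> xor4 (inord a) (inord b) =
    inord (nth 0 (nth [::] [:: [:: 0; 1; 2; 3]; [:: 1; 0; 3; 2];
                             [:: 2; 3; 0; 1]; [:: 3; 2; 1; 0]] a) b)%N.
  by move=> a4 b4; rewrite /xor4 !inordK.
have conj_nu' : (- 2 - nu)^* = nu by rewrite -nu_conj conjCK.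
have conj8 : (8^-1 : C)^* = 8^-1 by rewrite fmorphV rmorph_nat.
by move: p q; apply: I4_ind; apply: I4_ind; rewrite !sum_I4 !xorE //= !entry //=;
  rewrite !rmorphM /= conj8 ?conj_nu' ?nu_conj ?rmorph1 ?rmorph_nat;
  rewrite -!val_eqE /= !inordK //=; field: nu_sqr.
Qed.

Lemma KD_Omega_unitary (C : numClosedFieldType) {n} : (0 < n)%N ->
  star (KD_Omega C n) * KD_Omega C n = 1.
Proof.
move=> n_gt0; pose h := tnth (KD_h n); pose c := KD_c C.
have OmegaM k l : star (KD_Omega C n) * lam C (h k, h l) =
    \sum_p \sum_q (c (xor4 p k) (xor4 q l))^* *: lam C (h p, h q).
  (* h_i h_k is to be called h_p, so i is the sum of p and k. *)
  rewrite star_KD_OmegaE // (reindex_inj (inv_inj (xor4K k))) mulr_suml.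
  apply: eq_bigr => p _; rewrite (reindex_inj (inv_inj (xor4K l))) mulr_suml.
  apply: eq_bigr => q _; rewrite -scalerAl -lamM; congr (_ *: lam C (_, _)).
    by rewrite (KD_hM n_gt0) xor4K.
  by rewrite (KD_hM n_gt0) xor4K.
transitivity (\sum_k \sum_l \sum_p \sum_q
    ((c (xor4 p k) (xor4 q l))^* * c k l) *: lam C (h p, h q)).
  rewrite {2}KD_OmegaE mulr_sumr; apply: eq_bigr => k _.
  rewrite mulr_sumr; apply: eq_bigr => l _; rewrite -scalerAr OmegaM scaler_sumr.
  apply: eq_bigr => p _; rewrite scaler_sumr; apply: eq_bigr => q _.
  by rewrite scalerA mulrC.
transitivity (\sum_p \sum_q ((p == inord 0) && (q == inord 0))%:R
    *: lam C (h p, h q)).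
  under eq_bigr => k _ do rewrite exchange_big.
  rewrite exchange_big; apply: eq_bigr => p _.
  under eq_bigr => k _ do rewrite exchange_big.
  rewrite exchange_big; apply: eq_bigr => q _.
  rewrite -KD_c_unitary scaler_suml; apply: eq_bigr => k _.
  by rewrite scaler_suml.
rewrite (bigD1 (inord 0)) //= (bigD1 (inord 0)) //= !eqxx scale1r.
rewrite !big1 => [|p /negPf p0|q /negPf q0]; last by rewrite q0 andbF scale0r.
  by rewrite !addr0 /h !(tnth_nth 1%g) !inordK.
by rewrite big1 // => q _; rewrite p0 scale0r.
Qed.

(** * Slices *)

(** The second component of z along the basis element g of the first factor: z
    is the sum over g of lam g (x) slice g z. For a subspace I, an element is in
    K (x) I exactly when all its slices are in I; this replaces families of
    tensors by pointwise conditions. *)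
Definition slice {C : fieldType} {G H : finGroupType} (g : G)
  (z : galg C (G * H)%type) : galg C H := [ffun h => z (g, h)].

Lemma slice_is_linear (C : fieldType) (G H : finGroupType) (g : G) :
  linear (@slice C G H g).
Proof. by move=> c x y; apply/ffunP=> h; rewrite !ffunE. Qed.

HB.instance Definition _ (C : fieldType) (G H : finGroupType) (g : G) :=
  GRing.isLinear.Build C (galg C (G * H)%type) (galg C H) *:%R
    (@slice C G H g) (slice_is_linear C G H g).

Lemma slice_tens (C : fieldType) (G H : finGroupType) (g : G)
    (x : galg C G) (y : galg C H) : slice g (tens x y) = x g *: y.
Proof. by apply/ffunP=> h; rewrite !ffunE. Qed.

(** For a subalgebra I this shows that having all slices in I is stable under
    products. *)
Lemma sliceM (C : fieldType) (G H : finGroupType) (g : G)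
    (z w : galg C (G * H)%type) :
  slice g (z * w) = \sum_h slice h z * slice (h^-1 * g)%g w.
Proof.
apply/ffunP=> k; rewrite sum_ffunE !ffunE.
rewrite (eq_bigr (fun p => z (p.1, p.2) * w (p.1^-1 * g, p.2^-1 * k)%g)).
  rewrite -(pair_bigA _ (fun h l => z (h, l) * w (h^-1 * g, l^-1 * k)%g)) /=.
  by apply: eq_bigr => h _; rewrite ffunE; apply: eq_bigr => l _; rewrite !ffunE.
by case.
Qed.

Lemma memv_slice {C : fieldType} {G H : finGroupType} {U : {vspace galg C G}}
    {V : {vspace galg C H}} {z : galg C (G * H)%type} :
  z \in tensv U V -> forall g, slice g z \in V.
Proof.
move=> Uz g; set s := [seq tens u v | u <- vbasis U, v <- vbasis V].
rewrite (@coord_span _ _ _ (in_tuple s) z Uz) linear_sum memv_suml // => i _.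
rewrite linearZ memvZ //=.
have: (in_tuple s)`_i \in s by rewrite mem_nth.
case/allpairsP=> -[u v] [_ /= Vv ->]; rewrite slice_tens memvZ //.
exact: vbasis_mem.
Qed.

Lemma slice_coprod_s (C : numClosedFieldType) (G : finGroupType)
    (g : G) (x : galg C G) : slice g (coprod_s x) = x g *: lam C g.
Proof.
rewrite linear_sum (bigD1 g) //= linearZ /= -tens_lam slice_tens.
rewrite big1 => [|h]; first by rewrite ffunE eqxx scale1r addr0.
rewrite eq_sym linearZ /= -tens_lam slice_tens ffunE => /negPf->.
by rewrite scale0r scaler0.
Qed.

(** * Coideal subalgebras containing the group algebra of H *)

(** The scaled homomorphism sends each h_i of KD(d) to that of KD(n), hence
    Omega to Omega. *)
Lemma coprod_KD_phi {C : numClosedFieldType} {n d} (x : KD C d) :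
  (0 < n)%N -> (d %| n)%N ->
  KD_coprod (pushforward dih_scale x : KD C n)
    = pushforward (prodmap dih_scale) (KD_coprod x).
Proof.
move=> n_gt0 d_n; have thetaM := dih_scaleM n_gt0 d_n.
have OmegaE : pushforward (prodmap dih_scale) (KD_Omega C d) = KD_Omega C n.
  have theta1 : dih_scale (1 : dih d)%g = (1 : dih n)%g.
    by rewrite /dih_scale muln0.
  have theta_an : dih_scale (drot d ^+ d)%g = (drot n ^+ n)%g.
    by rewrite dih_scaleX // dih_scale_rot // -expgM divnK.
  have thetah i : dih_scale (tnth (KD_h d) i) = tnth (KD_h n) i.
    by move: i; apply: I4_ind; rewrite !(tnth_nth 1%g) !inordK //= ?thetaM
      ?theta_an ?dih_scale_refl.
  rewrite !KD_OmegaE linear_sum; apply: eq_bigr => i _.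
  rewrite linear_sum; apply: eq_bigr => j _.
  by rewrite linearZ /= pushforward_lam /prodmap !thetah.
rewrite /KD_coprod coprod_s_pushforward -OmegaE.
rewrite (star_pushforward _ (prodmapM thetaM)).
by rewrite !(pushforwardM (prodmapM thetaM)).
Qed.

Lemma is_phi_embedding {C : numClosedFieldType} {n d}
    {phi : 'AHom(KD C d, KD C n)} :
  (0 < n)%N -> (d %| n)%N -> is_phi phi ->
  kac_embedding (@KD_coprod C d) (@KD_coprod C n) phi.
Proof.
move=> n_gt0 d_n phiP; have thetaM := dih_scaleM n_gt0 d_n.
have phiE := is_phiE n_gt0 d_n phiP.
split=> [x y|x|x|x|x]; rewrite !phiE.
- exact: pushforward_inj (dih_scale_inj n_gt0 d_n) x y.
- by rewrite star_pushforward.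
- rewrite (coprod_KD_phi x n_gt0 d_n); apply: esym.
  exact: (@tensf_pushforward C _ _ dih_scale phi _ (is_phi_lam n_gt0 d_n phiP)).
- exact: counit_pushforward.
by rewrite antipode_pushforward.
Qed.

(** By compatibility with f, the coproduct of f x is a combination of tensors
    f (lam g) (x) f (lam h), whose two factors lie in the image. *)
Lemma kac_embedding_limg (C : numClosedFieldType) (G H : finGroupType)
    (coprodG : galg C G -> galg C (G * G)%type)
    (coprodH : galg C H -> galg C (H * H)%type)
    (f : 'AHom(galg C G, galg C H)) :
  kac_embedding coprodG coprodH f -> kac_subalgebra coprodH (limg f).
Proof.
case=> _ f_star f_coprod _ f_antipode.
have fI x : f x \in limg f by rewrite memv_img ?memvf.
have coprodI V : (limg f <= V)%VS ->
    {in limg f, forall x, coprodH x \in tensv V (limg f)}.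
  move=> sIV _ /memv_imgP[x _ ->]; rewrite f_coprod memv_suml // => p _.
  by rewrite memvZ // memv_tens // (subvP sIV).
split; [split | exact: coprodI |].
- by rewrite -(rmorph1 f) fI.
- move=> _ _ /memv_imgP[x _ ->] /memv_imgP[y _ ->].
  by rewrite -rmorphM fI.
- by move=> _ /memv_imgP[x _ ->]; rewrite -f_star.
- exact/coprodI/subvf.
by move=> _ /memv_imgP[x _ ->]; rewrite f_antipode.
Qed.

(** Conjugating back by Omega, which is possible inside K (x) I, recovers the
    group coproduct, whose slice at g is x g *: lam g. *)
Lemma coideal_lam {C : numClosedFieldType} {n} {I : {vspace KD C n}} :
  (0 < n)%N -> coideal_subalgebra (@KD_coprod C n) I ->
  (forall i, lam C (tnth (KD_h n) i) \in I) ->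
  {in I, forall (x : KD C n) g, x g != 0 -> lam C g \in I}.
Proof.
move=> n_gt0 [I1 IM _ Icoprod] Ih x Ix g xg.
pose sliceI (z : KD2 C n) := forall k, slice k z \in I.
have sliceIM z w : sliceI z -> sliceI w -> sliceI (z * w).
  by move=> Iz Iw k; rewrite sliceM memv_suml // => l _; apply: IM.
have Omega_sliceI (c : 'I_4 -> 'I_4 -> C) :
    sliceI (\sum_i \sum_j c i j *: lam C (tnth (KD_h n) i, tnth (KD_h n) j)).
  move=> k; rewrite linear_sum memv_suml // => i _.
  rewrite linear_sum memv_suml // => j _.
  by rewrite linearZ /= -tens_lam slice_tens !memvZ.
have Iomega : sliceI (KD_Omega C n) by rewrite KD_OmegaE.
have Iomega' : sliceI (star (KD_Omega C n)) by rewrite star_KD_OmegaE.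
have: sliceI (coprod_s x).
  have -> : coprod_s x = star (KD_Omega C n) * KD_coprod x * KD_Omega C n.
    rewrite /KD_coprod !mulrA KD_Omega_unitary // mul1r.
    by rewrite -mulrA KD_Omega_unitary // mulr1.
  apply: (sliceIM _ _ (sliceIM _ _ Iomega' _) Iomega).
  exact: memv_slice (Icoprod x Ix).
move=> /(_ g); rewrite slice_coprod_s => /(memvZ (x g)^-1).
by rewrite scalerA mulVf // scale1r.
Qed.

(** A subgroup of the dihedral group that contains b is determined by its
    rotations; as a^n is one of them, they are generated by a^k for some k that
    divides n. *)
Lemma coideal_is_limg {C : numClosedFieldType} {n} {I : {vspace KD C n}} :
  (0 < n)%N -> coideal_subalgebra (@KD_coprod C n) I ->
  {in <<[set (drot n ^+ n)%g; drefl n]>>%g,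
    forall h : dih n, lam C h \in I} ->
  exists2 d : nat, (d %| n)%N &
    exists2 phi : 'AHom(KD C d, KD C n), is_phi phi & I = limg phi.
Proof.
move=> n_gt0 coidealI IH; have [I1 IM _ _] := coidealI.
have an_I : (drot n ^+ n)%g \in <<[set (drot n ^+ n)%g; drefl n]>>%g.
  by rewrite mem_gen // !inE eqxx.
have b_I : drefl n \in <<[set (drot n ^+ n)%g; drefl n]>>%g.
  by rewrite mem_gen // !inE eqxx orbT.
have lamI : {in I, forall (x : KD C n) g, x g != 0 -> lam C g \in I}.
  apply: coideal_lam => //; apply: I4_ind; apply: IH;
    by rewrite (tnth_nth 1%g) inordK //= ?groupM.
have groupI : group_set [set g | lam C g \in I].
  apply/group_setP; split=> [|g h]; rewrite !inE // lamM; exact: IM.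
pose S := Group groupI.
have SE g : (g \in S) = (lam C g \in I) by rewrite inE.
have Sb : drefl n \in S by rewrite SE IH.
have ex_k : exists k, (0 < k)%N && ((drot n ^+ k)%g \in S).
  by exists n; rewrite n_gt0 SE IH.
case: (ex_minnP ex_k) => k /andP[k_gt0 Sk] k_min.
(* By minimality of k the remainder of m modulo k vanishes. *)
have k_dvd m : (drot n ^+ m)%g \in S -> (k %| m)%N.
  move=> Sm; rewrite /dvdn; case: posnP => // mod_gt0.
  have: (k <= m %% k)%N.
    apply: k_min; rewrite mod_gt0 -(groupMl _ (groupX (m %/ k) Sk)).
    by rewrite -expgM mulnC -expgD -divn_eq.
  by rewrite leqNgt ltn_pmod.
have k_n : (k %| n)%N by rewrite k_dvd // SE IH.
have d_n : (n %/ k %| n)%N by rewrite dvdn_div.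
have def_k : (n %/ (n %/ k))%N = k by rewrite divnA ?mulKn // divnn n_gt0 mul1n.
have [phi phiP] := is_phi_exists C n_gt0 d_n.
have [phi_a phi_b] := phiP; rewrite /KD_a def_k in phi_a.
rewrite /KD_b in phi_b.
exists (n %/ k)%N => //; exists phi => //; apply: subv_anti; apply/andP; split.
  apply/subvP=> x Ix; rewrite [x]lam_sum memv_suml // => -[i s] _.
  have [->|xg] := eqVneq (x (i, s)) 0; first by rewrite scale0r mem0v.
  have Sis : (drot n ^+ i * drefl n ^+ s)%g \in S.
    by rewrite drotXrefl SE (lamI x).
  have := k_dvd i; rewrite -(groupMr _ (groupX s Sb)) => /(_ Sis).
  rewrite -drotXrefl.
  case/dvdnP=> j def_i; rewrite memvZ // lamM !lamX def_i mulnC exprM.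
  rewrite -phi_a -phi_b -!rmorphXn -rmorphM.
  by rewrite memv_img ?memvf.
apply/subvP=> _ /memv_imgP[x _ ->]; rewrite [x]lam_sum linear_sum memv_suml //.
move=> [i s] _; rewrite linearZ memvZ //= -drotXrefl lamM !lamX rmorphM !rmorphXn.
rewrite /= phi_a phi_b -!lamX -lamM -SE.
by apply: groupM; apply: groupX.
Qed.

Theorem corollary5p4p2 (R : realType) (n : nat) (hn : (0 < n)%N) :
  (forall d : nat, (d %| n)%N ->
     (exists! phi : 'AHom(KD R[i] d, KD R[i] n), is_phi phi)
     /\ (forall phi : 'AHom(KD R[i] d, KD R[i] n), is_phi phi ->
           kac_embedding (@KD_coprod R[i] d) (@KD_coprod R[i] n) phi
           /\ kac_subalgebra (@KD_coprod R[i] n) (limg phi)))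
  /\ (forall I : {vspace KD R[i] n},
        coideal_subalgebra (@KD_coprod R[i] n) I ->
        {in <<[set (drot n ^+ n)%g; drefl n]>>%g,
          forall h : dih n, lam R[i] h \in I} ->
        exists2 d : nat, (d %| n)%N &
          exists2 phi : 'AHom(KD R[i] d, KD R[i] n), is_phi phi & I = limg phi).
Proof.
split=> [d d_n | I]; last exact: coideal_is_limg.
split=> [|phi phiP].
  have [phi phiP] := is_phi_exists R[i] hn d_n; exists phi; split=> // psi psiP.
  apply/val_inj/lfunP => x.
  by rewrite /= (is_phiE hn d_n phiP) (is_phiE hn d_n psiP).
have phi_emb := is_phi_embedding hn d_n phiP.
by split=> //; apply: kac_embedding_limg phi_emb.
Qed.
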